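(* For scheduling $n$ tasks on $m$ unrelated machines, the mechanism m-GBM, run with parameters $\alpha=1.4844$, $\beta=1.1854$, $r=0.7932$, is a universally truthful randomized mechanism whose expected makespan on every instance is at most $0.8369m$ times the optimal makespan.
   Context: Setting: there are $m$ machines and $n$ tasks; machine $i$ is a selfish agent with private type $t^i=(t^i_j)_{j\in[n]}$ of positive running times. A mechanism receives reported types and outputs an allocation (each task assigned to exactly one machine, $x^i_j\in\{0,1\}$) and payments $p^i$; agent $i$'s utility is $p^i-\sum_jx^i_jt^i_j$ (true times). Makespan of an allocation is $\max_i\sum_jx^i_jt^i_j$; the approximation ratio is $c$ if the expected makespan is at most $c$ times the optimal makespan on every instance. A randomized mechanism is universally truthful if for every fixing of its random bits the resulting deterministic mechanism is truthful (truth-telling maximizes each agent's utility regardless of the others' reports). Two-machine GBM rule for a single task $j$ between machines with values $u^1,u^2$ (parameters $\alpha>\beta\ge1>r\ge1/2$): draw $s_j$ equal to $\alpha$ w.p. $1-r$, $\beta$ w.p. $r-1/2$, $1/\beta$ w.p. $r-1/2$, $1/\alpha$ w.p. $1-r$, independently across tasks; if $u^1<s_ju^2$ the task goes to the first machine with GBM payment $s_ju^2$, otherwise to the second machine with GBM payment $s_j^{-1}u^1$. m-GBM: initialize empty allocations and zero payments. Partition the machines into two sets $S_1,S_2$ of equal size (if $m$ is odd, add an extra dummy machine with infinite running time on every task). For each task $j$: let $a=\arg\min_{i\in S_1}t^i_j$, $t^a=\min_{i\in S_1}t^i_j$, $t^{a'}=\min_{i\in S_1\setminus\{a\}}t^i_j$;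 let $b=\arg\min_{i\in S_2}t^i_j$, $t^b=\min_{i\in S_2}t^i_j$, $t^{b'}=\min_{i\in S_2\setminus\{b\}}t^i_j$ (a minimum over an empty set is $+\infty$). Apply the GBM rule to machines $a$ and $b$ with values $t^a,t^b$ on task $j$; if $a$ gets the task with GBM payment $p^a_j$, pay $a$ the amount $\min\{p^a_j,t^{a'}\}$; if $b$ gets the task with GBM payment $p^b_j$, pay $b$ the amount $\min\{p^b_j,t^{b'}\}$.
   Formalization: Stated for m ≥ 2, and for odd m the bound is 0.8369(m+1), counting the dummy machine, instead of 0.8369m: the bound 0.8369m fails for m = 1 and, for example, for m = 3. *)

(* Defs.v *)
From HB Require Import structures.
From mathcomp Require Import all_boot all_order all_algebra.
From mathcomp Require Import reals constructive_ereal ereal.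

Set Implicit Arguments.
Unset Strict Implicit.
Unset Printing Implicit Defensive.

Import Order.TTheory GRing.Theory Num.Theory.
Local Open Scope ring_scope.

Section Scheduling.
Context {R : realType} {m n : nat}.

(* [x i j] is the indicator of "task j runs on machine i". *)
Definition allocation := 'M[bool]_(m, n).

Definition feasible (x : allocation) : bool :=
  [forall j, #|[set i | x i j]| == 1%N].

Definition positive_types (t : 'M[R]_(m, n)) : Prop := forall i j, 0 < t i j.

Definition load (t : 'M[R]_(m, n)) (x : allocation) (i : 'I_m) : R :=
  \sum_(j < n) (x i j)%:R * t i j.

Definition makespan (t : 'M[R]_(m, n)) (x : allocation) : R :=
  \big[Num.max/0]_(i < m) load t x i.

Definition opt_makespan (t : 'M[R]_(m, n)) : \bar R :=
  \big[Order.min/+oo%E]_(x : allocation | feasible x) (makespan t x)%:E.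

(* Payments are extended reals because the rules below take minima over
   possibly empty sets; [is_mechanism] asks for them to be finite. *)
Definition mechanism : Type :=
  'M[R]_(m, n) -> allocation * ('I_m -> \bar R).

Definition is_mechanism (M : mechanism) : Prop :=
  forall t, positive_types t ->
    feasible (M t).1 /\ forall i, (M t).2 i \is a fin_num.

Definition utility (t : 'M[R]_(m, n)) (o : allocation * ('I_m -> \bar R))
    (i : 'I_m) : \bar R :=
  (o.2 i - (load t o.1 i)%:E)%E.

(* [t] holds the true type of agent [i] and the reports of the others. *)
Definition truthful (M : mechanism) : Prop :=
  forall (i : 'I_m) (t t' : 'M[R]_(m, n)),
    positive_types t -> positive_types t' ->
    (forall k j, k != i -> t' k j = t k j) ->
    (utility t (M t') i <= utility t (M t) i)%E.

Section Randomized.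
Variables (W : finType) (P : W -> R) (M : W -> mechanism).

Definition is_distribution : Prop :=
  (forall w, 0 <= P w) /\ \sum_w P w = 1.

Definition randomized_mechanism : Prop :=
  is_distribution /\ forall w, is_mechanism (M w).

Definition universally_truthful : Prop := forall w, truthful (M w).

Definition expected_makespan (t : 'M[R]_(m, n)) : R :=
  \sum_w P w * makespan t (M w t).1.

Definition approximation_ratio (c : R) : Prop :=
  forall t, positive_types t ->
    ((expected_makespan t)%:E <= c%:E * opt_makespan t)%E.

End Randomized.
End Scheduling.

Arguments allocation : clear implicits.
Arguments mechanism : clear implicits.

Section GBM.
Context {R : realType}.

Definition gbm_threshold (alpha beta : R) (k : 'I_4) : R :=
  nth 0 [:: alpha; beta; beta^-1; alpha^-1] k.

Definition gbm_weight (r : R) (k : 'I_4) : R :=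
  nth 0 [:: 1 - r; r - 2^-1; r - 2^-1; 1 - r] k.

(* The boolean tells whether the first machine wins; the second component is
   the payment to the winner. *)
Definition gbm_rule (s : R) (u1 u2 : \bar R) : bool * \bar R :=
  if (u1 < s%:E * u2)%E then (true, (s%:E * u2)%E)
  else (false, (s^-1%:E * u1)%E).

End GBM.

(* The number of machines m-GBM works with, counting the dummy added when m is
   odd. The ratio 0.8369 is per machine in this count: against the number of
   real machines it fails for odd m. Take m = 3 with machines 1, 2 on one side,
   and three tasks with times (1, 10, 10), (1, 1 + e, 10) and (67/100, 10, 1):
   machine 1 always gets all of them, so the makespan is 2.67, while the optimum
   is 1 + e and 3 * 0.8369 = 2.5107. *)
Definition padded (m : nat) : nat := (m + odd m)%N.

Section MGBM.
Context {R : realType} {m n : nat}.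
Implicit Types (S : {set 'I_(padded m)}) (u : 'I_(padded m) -> \bar R).

Definition padded_time (t : 'M[R]_(m, n)) (j : 'I_n) (i : 'I_(padded m)) :
    \bar R :=
  match split i with inl k => (t k j)%:E | inr _ => +oo%E end.

Definition min_time u S : \bar R := \big[Order.min/+oo%E]_(i in S) u i.

(* Ties go to the smallest index; [None] only when [S] is empty. *)
Definition argmin_time u S : option 'I_(padded m) :=
  [pick i in S | u i == min_time u S].

(* The winner of one task and its payment, for the partition (S, ~: S). *)
Definition mgbm_task S (s : R) u : option ('I_(padded m) * \bar R) :=
  match argmin_time u S, argmin_time u (~: S) with
  | Some a, Some b =>
      let: (first_wins, p) := gbm_rule s (u a) (u b) in
      Some (if first_wins then (a, Order.min p (min_time u (S :\ a)))
            else (b, Order.min p (min_time u (~: S :\ b))))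
  | _, _ => None
  end.

Definition mgbm_payment S (s : R) u (i : 'I_(padded m)) : \bar R :=
  if mgbm_task S s u is Some (w, p) then if w == i then p else 0%E else 0%E.

Definition mgbm (alpha beta : R) S (w : {ffun 'I_n -> 'I_4}) :
    mechanism R m n :=
  fun t =>
    let s j := gbm_threshold alpha beta (w j) in
    (\matrix_(i < m, j < n)
       (omap fst (mgbm_task S (s j) (padded_time t j))
          == Some (lshift (odd m) i)),
     fun i => (\sum_(j < n)
       mgbm_payment S (s j) (padded_time t j) (lshift (odd m) i))%E).

(* Independent thresholds across tasks. *)
Definition mgbm_prob (r : R) (w : {ffun 'I_n -> 'I_4}) : R :=
  \prod_(j < n) gbm_weight r (w j).

End MGBM.

(* Main.v *)
Require Import Defs.
From HB Require Import structures.
From mathcomp Require Import all_boot all_order all_algebra.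
From mathcomp Require Import reals constructive_ereal ereal.
From mathcomp Require Import zify ring lra.

(* Truthfulness: for each task a machine faces a price that does not depend on
   its own report, and it gets the task when its reported time is below the
   price and does not get it when its time is above.

   Approximation: each side of the partition acts as one machine whose time on a
   task is the minimum over the side. This at most multiplies the optimum by the
   size of a side, half of the number of machines, so it is enough that the GBM
   rule is 1.6738-approximate for two machines. For a fixed law of the
   allocation the expected makespan is convex in the running times; hence it is
   largest when the work of each of the two optimal loads sits in a single task.
   A task whose times are in ratio [k] is moved off its optimal machine with
   probability 0, [1 - r], [1/2], [r] or 1, according to the position of [k]
   among [alpha], [beta] and their inverses, which leaves 25 pairs of tasks. *)

Set Implicit Arguments.
Unset Strict Implicit.
Unset Printing Implicit Defensive.

Import Order.TTheory GRing.Theory Num.Theory.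
Local Open Scope ring_scope.

(** * Moments under a product distribution *)

Section Independence.
Variables (R : comNzRingType) (I K : finType) (p : K -> R).
Hypothesis p1 : \sum_k p k = 1.

(** Distributivity of product over sum. Taking [h] equal to 1 outside one or two coordinates gives
    the two moments below. *)
Lemma sum_ffun_prod (h : I -> K -> R) :
  \sum_(w : {ffun I -> K}) (\prod_i p (w i)) * \prod_i h i (w i)
  = \prod_i \sum_k p k * h i k.
Proof.
by rewrite bigA_distr_bigA; apply: eq_bigr => w _; rewrite big_split.
Qed.

Lemma sum_ffun_cst : \sum_(w : {ffun I -> K}) \prod_i p (w i) = 1.
Proof. by rewrite -(bigA_distr_bigA (fun=> p)) big1. Qed.

Lemma sum_ffun_coord (i : I) (f : K -> R) :
  \sum_(w : {ffun I -> K}) (\prod_l p (w l)) * f (w i) = \sum_k p k * f k.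
Proof.
have := sum_ffun_prod (fun l => if l == i then f else fun=> 1).
rewrite [RHS](bigD1 i) //= eqxx [X in _ * X]big1 => [|l /negPf->]; last first.
  by under eq_bigr do rewrite mulr1.
rewrite mulr1 => <-; apply: eq_bigr => w _.
congr (_ * _).
by rewrite (bigD1 i) //= eqxx big1 ?mulr1 // => l /negPf->.
Qed.

Lemma sum_ffun_coord2 (i j : I) (f g : K -> R) : i != j ->
  \sum_(w : {ffun I -> K}) (\prod_l p (w l)) * (f (w i) * g (w j))
  = (\sum_k p k * f k) * (\sum_k p k * g k).
Proof.
move=> ij.
have := sum_ffun_prod (fun l =>
  if l == i then f else if l == j then g else fun=> 1).
have ji : j != i by rewrite eq_sym.
rewrite [RHS](bigD1 i) //= eqxx (bigD1 j ji) /= (negPf ji) eqxx.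
rewrite [X in _ * (_ * X)]big1 => [|l /andP[/negPf-> /negPf->]]; last first.
  by under eq_bigr do rewrite mulr1.
rewrite mulr1 => <-; apply: eq_bigr => w _.
congr (_ * _); rewrite (bigD1 i) //= eqxx (bigD1 j ji) /= (negPf ji) eqxx.
by rewrite big1 ?mulr1 // => l /andP[/negPf-> /negPf->].
Qed.

End Independence.

(** * Two tasks that the optimum puts on different machines *)

Section TwoTasks.
Variable R : realType.

(* Numerals are unary, so [lra] is only fast on small ones. *)
Lemma hundredths (a b : nat) :
  (a * 100 + b)%N%:R / 10000 = a%:R / 100 + b%:R / 100 / 100 :> R.
Proof.
have -> : 10000 = 100 * 100 :> R by rewrite -natrM.
by rewrite natrD natrM; field.
Qed.

Variables alpha beta r ratio : R.
Hypothesis alphaE : alpha = 148 / 100 + 44 / 100 / 100.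
Hypothesis betaE : beta = 118 / 100 + 54 / 100 / 100.
Hypothesis ratioE : ratio = 167 / 100 + 38 / 100 / 100.
Hypothesis rE : r = 79 / 100 + 32 / 100 / 100.

(* A task takes time 1 where the optimum runs it and time [k] on the other
   machine, where the mechanism moves it with probability [p]. *)
Definition move_bound (p k : R) : Prop :=
  [\/ p = 0, p = 1 - r /\ k <= alpha, p = 2^-1 /\ k <= beta
    | p = r /\ k <= beta^-1 \/ p = 1 /\ k <= alpha^-1].

(* The makespan of two such tasks that the optimum puts on different machines,
   as a function of the indicators [z], [z'] that they are moved. *)
Definition pair_makespan (k k' z z' : R) : R :=
  (1 - z) * (1 - z') + z * (1 - z') * (1 + k)
  + (1 - z) * z' * (1 + k') + z * z' * Num.max k k'.

Lemma pair_makespan_le k k' p p' : move_bound p k -> move_bound p' k' ->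
  pair_makespan k k' p p' <= ratio.
Proof.
rewrite ratioE /pair_makespan /move_bound => hk hk'.
(* This bound is exactly [ratio - 1], as the case [p = 1], [p' = 0] requires: there the makespan is
   [1 + k]. The bound on [beta^-1] is its value rounded up. *)
have alphaV : alpha^-1 <= 67 / 100 + 38 / 100 / 100.
  by rewrite -[_^-1]mul1r ler_pdivrMr alphaE; lra.
have betaV : beta^-1 <= 84 / 100 + 36 / 100 / 100.
  by rewrite -[_^-1]mul1r ler_pdivrMr betaE; lra.
(* With the inverses turned into bounded variables, each of the 25 cases is linear in [k] and [k']
   once the maximum is resolved. *)
move: (alpha^-1) (beta^-1) alphaV betaV hk hk' => av bv alphaV betaV.
rewrite alphaE betaE rE.
case=> [->|[-> h]|[-> h]|[[-> h]|[-> h]]];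
  case=> [->|[-> h']|[-> h']|[[-> h']|[-> h']]];
  by case: (leP k k') => hkk'; lra.
Qed.

(** The two left-hand sides are the loads of the machines: each keeps its own task unless it is
    moved, and receives the other one if that is moved. *)
Lemma pair_makespan_ge (k k' : R) (z z' : bool) : 0 <= k -> 0 <= k' ->
  1 - z%:R + k' * z'%:R <= pair_makespan k k' z%:R z'%:R /\
  k * z%:R + (1 - z'%:R) <= pair_makespan k k' z%:R z'%:R.
Proof.
rewrite /pair_makespan.
by case: z; case: z' => /=; case: (leP k k') => h; split=> //=; lra.
Qed.

(** [pair_makespan] is affine in [z], [z'] and [z * z'], so its mean depends only on the means of
    these three. *)
Lemma pair_makespan_mean (W : finType) (P Z Z' : W -> R) (k k' p p' : R) :
  \sum_w P w = 1 -> \sum_w P w * Z w = p -> \sum_w P w * Z' w = p' ->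
  \sum_w P w * (Z w * Z' w) = p * p' ->
  \sum_w P w * pair_makespan k k' (Z w) (Z' w) = pair_makespan k k' p p'.
Proof.
move=> P1 Ep Ep' Epp'.
have affine x y : pair_makespan k k' x y =
    1 + k * x + k' * y + (Num.max k k' - 1 - k - k') * (x * y).
  by rewrite /pair_makespan; ring.
rewrite affine -{1}P1 -Epp' -Ep -Ep' !mulr_sumr -!big_split /=.
by apply: eq_bigr => w _; rewrite affine; ring.
Qed.

(** * The law of the threshold and the probability of a move *)

Local Notation s := (gbm_threshold alpha beta).
Local Notation wt := (gbm_weight r).

Lemma sum_gbm_weight (f : 'I_4 -> R) :
  \sum_k wt k * f k =
  (1 - r) * f ord0 + (r - 2^-1) * f (lift ord0 ord0)
  + (r - 2^-1) * f (lift ord0 (lift ord0 ord0))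
  + (1 - r) * f (lift ord0 (lift ord0 (lift ord0 ord0))).
Proof. by rewrite !big_ord_recl big_ord0 /gbm_weight /= addr0 !addrA. Qed.

Lemma gbm_weight_ge0 (k : 'I_4) : 0 <= wt k.
Proof.
case: k => -[|[|[|[|//]]]] h; rewrite /gbm_weight /= rE; lra.
Qed.

Lemma gbm_weight_sum : \sum_k wt k = 1.
Proof.
under eq_bigr do rewrite -[gbm_weight _ _]mulr1.
by rewrite sum_gbm_weight; field.
Qed.

Lemma gbm_threshold_gt0 (k : 'I_4) : 0 < s k.
Proof.
by case: k => -[|[|[|[|//]]]] h;
  rewrite /gbm_threshold /= ?invr_gt0 ?alphaE ?betaE; lra.
Qed.

Lemma gbm_threshold_lt :
  [/\ 0 < alpha, 0 < beta, alpha^-1 < beta^-1, beta^-1 < beta & beta < alpha].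
Proof.
have b0 : 0 < beta by rewrite betaE; lra.
have ab : beta < alpha by rewrite alphaE betaE; lra.
have a0 := lt_trans b0 ab.
split=> //; first by rewrite ltf_pV2.
apply: (@lt_trans _ _ 1); last by rewrite betaE; lra.
by rewrite invf_lt1 // betaE; lra.
Qed.

(** The task is moved when [s^-1 >= y / x], so the probability is a partial sum of the weights: 1,
    [r], [1/2], [1 - r] or 0 as [y / x] grows. *)
Lemma first_moved_bound (x y : R) : 0 < x -> 0 < y ->
  move_bound (\sum_k wt k * (~~ (x < s k * y))%:R) (y / x).
Proof.
move=> x0 y0; have [a0 b0 ab bb ba] := gbm_threshold_lt.
rewrite sum_gbm_weight /gbm_threshold /= /move_bound.
have mulE c : 0 < c -> (x < c * y) = (c^-1 < y / x).
  by move=> c0; rewrite ltr_pdivlMr // ltr_pdivrMl.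
rewrite !mulE ?invr_gt0 // !invrK -!leNgt.
move: (alpha^-1) (beta^-1) (y / x) ab bb => av bv u ab bb.
have [h1|h1] := leP u av.
  by constructor 4; right; rewrite !(le_trans h1) /=;
    [split=> //=; lra | lra..].
have [h2|h2] := leP u bv.
  by constructor 4; left; rewrite !(le_trans h2) /=;
    [split=> //=; lra | lra..].
have [h3|h3] := leP u beta.
  by constructor 3; rewrite !(le_trans h3) /=; [split=> //=; lra | lra..].
have [h4|h4] := leP u alpha.
  by constructor 2; split=> //=; lra.
by constructor 1; rewrite /=; lra.
Qed.

(** Here the task is moved when [y / x < s]. The law of [s] is invariant under inversion, so the
    partial sums are the same; ties fit because [move_bound] uses weak inequalities. *)
Lemma second_moved_bound (x y : R) : 0 < x -> 0 < y ->
  move_bound (\sum_k wt k * (y < s k * x)%R%:R) (y / x).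
Proof.
move=> x0 y0; have [a0 b0 ab bb ba] := gbm_threshold_lt.
rewrite sum_gbm_weight /gbm_threshold /= /move_bound -!ltr_pdivrMr //.
move: (alpha^-1) (beta^-1) (y / x) ab bb => av bv u ab bb.
have [h1|h1] := ltP u av.
  by constructor 4; right; rewrite !(lt_le_trans h1) /=;
    [split=> //=; lra | lra..].
have [h2|h2] := ltP u bv.
  by constructor 4; left; rewrite !(lt_le_trans h2) /=;
    [split=> //=; lra | lra..].
have [h3|h3] := ltP u beta.
  by constructor 3; rewrite !(lt_le_trans h3) /=; [split=> //=; lra | lra..].
have [h4|h4] := ltP u alpha.
  by constructor 2; split=> //=; lra.
by constructor 1; rewrite /=; lra.
Qed.

(** * Reduction of the two-machine makespan to pairs of tasks *)

Lemma sum_option (I : finType) (F : option I -> R) :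
  \sum_o F o = F None + \sum_i F (Some i).
Proof.
rewrite (bigD1 None) //= (reindex_omap Some id) /=; last by case.
by congr (_ + _); apply: eq_bigl => i; rewrite eqxx.
Qed.

Lemma sum_sum_mul (I : finType) (mu nu f g : I -> R) (T : R) :
  \sum_i mu i = T -> \sum_i nu i = T ->
  \sum_i \sum_j mu i * nu j * (f i + g j)
  = T * (\sum_i mu i * f i + \sum_j nu j * g j).
Proof.
move=> muT nuT.
under eq_bigr => i _.
  have -> : \sum_j mu i * nu j * (f i + g j) =
      mu i * f i * T + mu i * \sum_j nu j * g j.
    rewrite -nuT !mulr_sumr -big_split; apply: eq_bigr => j _ /=; ring.
  over.
rewrite big_split /= -!mulr_suml muT; ring.
Qed.

(* The makespan is convex in the running times for a fixed law of the
   allocation, so the worst case has all the work of each of the two optimal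
   loads in a single task. Concretely, [T * makespan] is at most the average of
   [pair_makespan] over pairs of tasks weighted by their running times; the
   index [None] is a task that is never moved, taking up the slack. *)
Lemma two_machine_makespan (I : finType) (a b : I -> R) (O : pred I) (T : R) :
  (forall i, 0 < a i) -> (forall i, 0 < b i) -> 0 < T ->
  \sum_(i | O i) a i <= T -> \sum_(i | ~~ O i) b i <= T ->
  \sum_(w : {ffun I -> 'I_4}) (\prod_i wt (w i)) *
     Num.max (\sum_i (a i < s (w i) * b i)%R%:R * a i)
             (\sum_i (~~ (a i < s (w i) * b i))%:R * b i)
  <= ratio * T.
Proof.
move=> a0 b0 T0 aT bT.
pose win i k := a i < s k * b i.
(* [mu] and [nu] carry the running times of the tasks placed by the optimum on the first and on the
   second machine; the mass at [None] brings both totals to [T]. *)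
pose mu o := if o is Some i then if O i then a i else 0
             else T - \sum_(i | O i) a i.
pose nu o := if o is Some i then if O i then 0 else b i
             else T - \sum_(i | ~~ O i) b i.
pose k o := if o is Some i then b i / a i else 0.
pose k' o := if o is Some i then a i / b i else 0.
pose z o (w : {ffun I -> 'I_4}) :=
  if o is Some i then ~~ win i (w i) else false.
pose z' o (w : {ffun I -> 'I_4}) :=
  if o is Some i then win i (w i) else false.
pose p o := if o is Some i then \sum_c wt c * (~~ win i c)%:R else 0.
pose p' o := if o is Some i then \sum_c wt c * (win i c)%:R else 0.
have mu_ge0 o : 0 <= mu o.
  by case: o => [i|] /=; [case: ifP; rewrite // ltW | rewrite subr_ge0].
have nu_ge0 o : 0 <= nu o.
  by case: o => [i|] /=; [case: ifP; rewrite // ltW | rewrite subr_ge0].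
have muT : \sum_o mu o = T.
  by rewrite sum_option /= -big_mkcond subrK.
have nuT : \sum_o nu o = T.
  rewrite sum_option /= -[RHS](subrK (\sum_(i | ~~ O i) b i)); congr (_ + _).
  by rewrite [RHS]big_mkcond; apply: eq_bigr => i _; case: ifP.
have k_ge0 o : 0 <= k o by case: o => [i|] //=; rewrite divr_ge0 // ltW.
have k'_ge0 o : 0 <= k' o by case: o => [i|] //=; rewrite divr_ge0 // ltW.
have p_bound o : move_bound (p o) (k o).
  by case: o => [i|]; [exact: first_moved_bound | constructor 1].
have p'_bound o : move_bound (p' o) (k' o).
  by case: o => [i|]; [exact: second_moved_bound | constructor 1].
pose pm o o' w := pair_makespan (k o) (k' o') (z o w)%:R (z' o' w)%:R.
(* The first load is recovered from the pairs: a kept task contributes [mu = a i], a received one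
   [nu * k' = b i * (a i / b i) = a i], and [None] only adds nonnegative slack. *)
have le1 (w : {ffun I -> 'I_4}) : T * (\sum_i (win i (w i))%:R * a i) <=
    \sum_o \sum_o' mu o * nu o' * pm o o' w.
  apply: (@le_trans _ _ (\sum_o \sum_o' mu o * nu o' *
      ((1 - (z o w)%:R) + k' o' * (z' o' w)%:R))); last first.
    apply: ler_sum => o _; apply: ler_sum => o' _.
    rewrite ler_wpM2l ?mulr_ge0 //.
    by have [] := pair_makespan_ge (z o w) (z' o' w) (k_ge0 o) (k'_ge0 o').
  rewrite (sum_sum_mul _ _ muT nuT) ler_wpM2l ?(ltW T0) //.
  rewrite !sum_option /= subr0 mulr1 !mulr0 add0r -addrA -big_split /=.
  rewrite ler_wpDl ?subr_ge0 // ler_sum // => i _.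
  case: (O i); case: (win _ _) => /=;
    rewrite ?mul0r ?mul1r ?subrr ?subr0 ?mulr0 ?addr0 ?mulr1 ?add0r //.
  by rewrite mulrC divfK // gt_eqF.
have le2 (w : {ffun I -> 'I_4}) : T * (\sum_i (~~ win i (w i))%:R * b i) <=
    \sum_o \sum_o' mu o * nu o' * pm o o' w.
  apply: (@le_trans _ _ (\sum_o \sum_o' mu o * nu o' *
      (k o * (z o w)%:R + (1 - (z' o' w)%:R)))); last first.
    apply: ler_sum => o _; apply: ler_sum => o' _.
    rewrite ler_wpM2l ?mulr_ge0 //.
    by have [] := pair_makespan_ge (z o w) (z' o' w) (k_ge0 o) (k'_ge0 o').
  rewrite (sum_sum_mul _ _ muT nuT) ler_wpM2l ?(ltW T0) //.
  rewrite !sum_option /= subr0 mulr1 !mulr0 add0r addrCA -big_split /=.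
  rewrite ler_wpDl ?subr_ge0 // ler_sum // => i _.
  case: (O i); case: (win _ _) => /=;
    rewrite ?mul0r ?mul1r ?subrr ?subr0 ?mulr0 ?addr0 ?mulr1 ?add0r //.
  by rewrite mulrC divfK // gt_eqF.
have P_ge0 (w : {ffun I -> 'I_4}) : 0 <= \prod_i wt (w i).
  by apply: prodr_ge0 => i _; apply: gbm_weight_ge0.
have Ez o : \sum_(w : {ffun I -> 'I_4}) (\prod_i wt (w i)) * (z o w)%:R = p o.
  case: o => [i|] /=; last by rewrite big1 // => w _; rewrite mulr0.
  by rewrite -(sum_ffun_coord gbm_weight_sum i (fun c => (~~ win i c)%:R)).
have Ez' o :
    \sum_(w : {ffun I -> 'I_4}) (\prod_i wt (w i)) * (z' o w)%:R = p' o.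
  case: o => [i|] /=; last by rewrite big1 // => w _; rewrite mulr0.
  by rewrite -(sum_ffun_coord gbm_weight_sum i (fun c => (win i c)%:R)).
(* A task is not independent of itself, but for [i = j] one of [mu], [nu] vanishes, as they live on
   complementary sets of tasks. *)
have Ezz' o o' : mu o * nu o' != 0 ->
    \sum_(w : {ffun I -> 'I_4}) (\prod_i wt (w i)) * ((z o w)%:R * (z' o' w)%:R)
    = p o * p' o'.
  case: o o' => [i|] [j|] /=; last 3 first.
  - by move=> _; rewrite [RHS]mulr0 big1 // => w _; rewrite !mulr0.
  - by move=> _; rewrite [RHS]mul0r big1 // => w _; rewrite mul0r mulr0.
  - by move=> _; rewrite [RHS]mul0r big1 // => w _; rewrite mul0r mulr0.
  have [->|ij _] := eqVneq i j.
    by case: (O j); rewrite ?mul0r ?mulr0 eqxx.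
  by rewrite -(sum_ffun_coord2 gbm_weight_sum (fun c => (~~ win i c)%:R)
                              (fun c => (win j c)%:R) ij).
rewrite -(ler_pM2l T0) mulr_sumr.
apply: (@le_trans _ _ (\sum_(w : {ffun I -> 'I_4}) (\prod_i wt (w i)) *
    \sum_o \sum_o' mu o * nu o' * pm o o' w)).
  apply: ler_sum => w _; rewrite mulrCA ler_wpM2l //.
  by rewrite maxr_pMr ?(ltW T0) // ge_max le1 le2.
(* The weights [mu o * nu o'] sum to [T * T], so it suffices to compare with [ratio] pair by
   pair. *)
have -> : T * (ratio * T) = \sum_o \sum_o' mu o * nu o' * ratio.
  under eq_bigr do rewrite -mulr_suml -mulr_sumr nuT.
  by rewrite -!mulr_suml muT; ring.
under eq_bigr do rewrite mulr_sumr.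
rewrite exchange_big; apply: ler_sum => o _ /=.
under eq_bigr do rewrite mulr_sumr.
rewrite exchange_big; apply: ler_sum => o' _ /=.
under eq_bigr do rewrite mulrCA.
rewrite -mulr_sumr.
have [->|munu] := eqVneq (mu o * nu o') 0; first by rewrite !mul0r.
rewrite ler_wpM2l ?mulr_ge0 //.
rewrite (@pair_makespan_mean _ _ _ _ _ _ (p o) (p' o')) //.
- exact: pair_makespan_le.
- exact: sum_ffun_cst gbm_weight_sum.
- exact: Ezz'.
Qed.

End TwoTasks.

(** * Prices faced by a machine on a single task *)

Section Price.
Variables (R : realType) (m : nat) (S : {set 'I_(padded m)}).
Implicit Types (A : {set 'I_(padded m)}) (u : 'I_(padded m) -> \bar R).

Lemma min_time_le u A i : i \in A -> (min_time u A <= u i)%E.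
Proof. by move=> iA; exact: bigmin_le_cond. Qed.

Lemma min_time_gt0 u A : (forall i, 0 < u i)%E -> (0 < min_time u A)%E.
Proof. by move=> u0; apply: lt_bigmin => [|i _]; [exact: ltry | exact: u0]. Qed.

Lemma min_time_fin_num u A i : (forall i, 0 < u i)%E -> i \in A ->
  u i \is a fin_num -> min_time u A \is a fin_num.
Proof.
move=> u0 iA ui; rewrite ge0_fin_numE ?ltW ?min_time_gt0 //.
by rewrite (le_lt_trans (min_time_le u iA)) // ltey_eq ui.
Qed.

Lemma min_time_setD1_ge u A i : (min_time u A <= min_time u (A :\ i))%E.
Proof.
apply: le_bigmin => [|k]; first exact: leey.
by rewrite in_setD1 => /andP[_ kA]; exact: min_time_le.
Qed.

Lemma eq_min_time u u' A : {in A, u =1 u'} -> min_time u A = min_time u' A.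
Proof. by move=> uu'; apply: eq_bigr. Qed.

Lemma argmin_timeP u A : A != set0 ->
  exists a, [/\ argmin_time u A = Some a, a \in A & u a = min_time u A].
Proof.
case/set0Pn => i iA; rewrite /argmin_time.
case: pickP => [a /andP[aA /eqP ua]|none].
  by exists a.
have [k kA ek] := eq_bigmin (x := +oo%E) i (mem A) u iA (fun k _ => leey (u k)).
by have := none k; rewrite kA /min_time ek eqxx.
Qed.

Definition wins (s : R) u i : bool := omap fst (mgbm_task S s u) == Some i.

(* The payment to [i] if it gets the task; it does not depend on [u i]. *)
Definition price (s : R) u i : \bar R :=
  if i \in S then Order.min (s%:E * min_time u (~: S))%E (min_time u (S :\ i))
  else Order.min (s^-1%:E * min_time u S)%E (min_time u (~: S :\ i)).

Hypotheses (SN0 : S != set0) (CN0 : ~: S != set0).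

(** The GBM rule compares the two side minima, and the GBM payment uses only the minimum of the
    losing side; hence the winner is paid its [price]. *)
Lemma mgbm_taskP s u : exists a b,
  [/\ a \in S, u a = min_time u S, b \in ~: S, u b = min_time u (~: S) &
   mgbm_task S s u =
     let w := if (min_time u S < s%:E * min_time u (~: S))%E then a else b in
     Some (w, price s u w)].
Proof.
have [a [ea aS ua]] := argmin_timeP u SN0.
have [b [eb bS ub]] := argmin_timeP u CN0.
exists a, b; split=> //; rewrite /mgbm_task ea eb /gbm_rule ua ub.
have bNS : (b \in S) = false by apply/negbTE; rewrite -in_setC.
by case: ifP => _; rewrite /price ?aS ?bNS.
Qed.

Lemma mgbm_paymentE s u i :
  mgbm_payment S s u i = if wins s u i then price s u i else 0%E.
Proof.
rewrite /mgbm_payment /wins; have [a [b [_ _ _ _ ->]]] /= := mgbm_taskP s u.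
by rewrite (inj_eq Some_inj); case: eqP => [<-|].
Qed.

Lemma winsP s u i : wins s u i ->
  if i \in S then u i = min_time u S /\
    (min_time u S < s%:E * min_time u (~: S))%E
  else u i = min_time u (~: S) /\
    (s%:E * min_time u (~: S) <= min_time u S)%E.
Proof.
rewrite /wins; have [a [b [aS ua bS ub ->]]] /= := mgbm_taskP s u.
have bNS : (b \in S) = false by apply/negbTE; rewrite -in_setC.
by case: ltP => h /eqP[<-]; rewrite ?aS ?bNS.
Qed.

Lemma wins_le_price s u i : 0 < s -> wins s u i -> (u i <= price s u i)%E.
Proof.
move=> s0 /winsP; rewrite /price; case: ifP => _ [-> h];
  rewrite le_min min_time_setD1_ge andbT.
  exact: ltW.
by rewrite lee_pdivlMl.
Qed.

(** There are two ways to lose. If another machine of the side is selected, its time bounds the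
    second argument of the minimum; if [i] is selected and its side loses, the GBM comparison bounds
    the first. *)
Lemma price_le_loses s u i : 0 < s -> ~~ wins s u i -> (price s u i <= u i)%E.
Proof.
move=> s0; rewrite /wins; have [a [b [aS ua bS ub ->]]] /= := mgbm_taskP s u.
rewrite (inj_eq Some_inj) /price => ne; case: ifPn => iS; rewrite ge_min.
  have [ai|ai] := eqVneq a i; last first.
    apply/orP; right; rewrite (@le_trans _ _ (u a)) //.
      by rewrite min_time_le // in_setD1 ai.
    by rewrite ua min_time_le.
  by move: ne; rewrite -ai ua; case: ltP; rewrite ?eqxx // => ->.
have iC : i \in ~: S by rewrite in_setC.
have [bi|bi] := eqVneq b i; last first.
  apply/orP; right; rewrite (@le_trans _ _ (u b)) //.
    by rewrite min_time_le // in_setD1 bi.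
  by rewrite ub min_time_le.
move: ne; rewrite -bi ub lee_pdivrMl //.
by case: ltP; rewrite ?eqxx // => /ltW ->.
Qed.

Lemma eq_price s u u' i : (forall k, k != i -> u k = u' k) ->
  price s u i = price s u' i.
Proof.
move=> uu'; rewrite /price; case: ifPn => iS; congr (Order.min (_ * _)%E _);
  apply: eq_min_time => k; rewrite ?in_setD1 ?in_setC => kA; apply: uu'.
- by apply: contraNneq kA => ->.
- by case/andP: kA.
- by apply: contraNneq iS => <-.
- by case/andP: kA.
Qed.

(** The second argument of the minimum may be [+oo], for instance for a machine alone on its side;
    the first is always finite. *)
Lemma price_fin_num (s : R) u i k l : (forall i, 0 < u i)%E ->
  k \in S -> u k \is a fin_num -> l \in ~: S -> u l \is a fin_num ->
  price s u i \is a fin_num.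
Proof.
move=> u0 kS uk lS ul.
have fS := min_time_fin_num u0 kS uk; have fC := min_time_fin_num u0 lS ul.
have min_fin (x y : \bar R) : x \is a fin_num -> (0 <= y)%E ->
    Order.min x y \is a fin_num.
  move=> fx y0; rewrite minEle; case: leP => // yx.
  by rewrite ge0_fin_numE // (lt_trans yx) // ltey_eq fx.
by rewrite /price; case: ifP => _; rewrite min_fin ?fin_numM ?ltW ?min_time_gt0.
Qed.

End Price.

(** * Feasibility, truthfulness and makespan of m-GBM *)

Section Mechanism.
Variables (R : realType) (m n : nat) (S : {set 'I_(padded m)}).
Hypotheses (m_gt1 : (1 < m)%N) (card_S : #|S| = #|~: S|).
Implicit Types (t : 'M[R]_(m, n)) (x : allocation m n).

Local Notation real_machine := (lshift (odd m)).

Lemma padded_time_real t j i : padded_time t j (real_machine i) = (t i j)%:E.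
Proof. by rewrite /padded_time (unsplitK (inl _ i)). Qed.

Lemma padded_time_gt0 t j i : positive_types t -> (0 < padded_time t j i)%E.
Proof. by rewrite /padded_time => t0; case: split => k //; rewrite lte_fin. Qed.

Lemma padded_time_fin_num t j i : padded_time t j i \is a fin_num ->
  exists k, i = real_machine k.
Proof.
rewrite /padded_time; case: (splitP i) => k ik //= _.
by exists k; apply: val_inj.
Qed.

Lemma card_side : (#|S| * 2 = padded m)%N.
Proof. by rewrite muln2 -addnn {2}card_S cardsC card_ord. Qed.

(* There is at most one dummy, and a side with the dummy has another machine. *)
Lemma exists_real_machine (A : {set 'I_(padded m)}) : #|A| = #|S| ->
  exists k, real_machine k \in A.
Proof.
move=> cardA; apply/existsP; apply: contraT.
rewrite negb_exists => /forallP none.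
have : A \subset [set rshift m k | k : 'I_(odd m)].
  apply/subsetP => i iA; case: (splitP i) => k ik; last first.
    by apply/imsetP; exists k => //; apply: val_inj.
  by have := none k; rewrite (_ : real_machine k = i) ?iA //; apply: val_inj.
move=> /subset_leq_card /leq_trans/(_ (leq_imset_card _ _)).
rewrite cardA cardT size_enum_ord; have := card_side.
move: (leq_b1 (odd m)); rewrite /padded; move: #|S| m_gt1 => c.
by move: (nat_of_bool _) => o; lia.
Qed.

Lemma exists_real_S : exists k, real_machine k \in S.
Proof. exact: exists_real_machine. Qed.

Lemma exists_real_C : exists k, real_machine k \in ~: S.
Proof. exact: exists_real_machine. Qed.

Lemma S_neq0 : S != set0.
Proof. by apply/set0Pn; have [k kS] := exists_real_S; exists (lshift _ k). Qed.

Lemma C_neq0 : ~: S != set0.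
Proof. by apply/set0Pn; have [k kS] := exists_real_C; exists (lshift _ k). Qed.

Lemma min_time_real_fin_num t j (A : {set 'I_(padded m)}) :
  positive_types t -> #|A| = #|S| -> min_time (padded_time t j) A \is a fin_num.
Proof.
move=> t0 cardA; have [k kA] := exists_real_machine cardA.
apply: (min_time_fin_num _ kA) => [i|]; first exact: padded_time_gt0.
by rewrite padded_time_real.
Qed.

Variables alpha beta : R.
Hypothesis threshold_gt0 : forall k, 0 < gbm_threshold alpha beta k.
Implicit Type w : {ffun 'I_n -> 'I_4}.

Local Notation s w j := (gbm_threshold alpha beta (w j)).
Local Notation M := (mgbm alpha beta S).

Definition gets w t i j : bool :=
  wins S (s w j) (padded_time t j) (real_machine i).

Definition task_price w t i j : R :=
  fine (price S (s w j) (padded_time t j) (real_machine i)).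

Lemma task_priceE w t i j : positive_types t ->
  price S (s w j) (padded_time t j) (real_machine i) = (task_price w t i j)%:E.
Proof.
move=> t0; have [k kS] := exists_real_S; have [l lC] := exists_real_C.
rewrite fineK // (price_fin_num _ _ _ kS _ lC) ?padded_time_real // => i'.
exact: padded_time_gt0.
Qed.

Lemma mgbm_allocationE w t i j : (M w t).1 i j = gets w t i j.
Proof. by rewrite mxE. Qed.

Lemma mgbm_paymentsE w t i : positive_types t ->
  (M w t).2 i = (\sum_j (gets w t i j)%:R * task_price w t i j)%:E.
Proof.
move=> t0; rewrite -sumEFin; apply: eq_bigr => j _.
rewrite mgbm_paymentE ?S_neq0 ?C_neq0 // task_priceE // -/(gets w t i j).
by case: gets; rewrite ?mul1r ?mul0r.
Qed.

(** The winner of a task attains the minimum of its side. Each side has a real machine, so this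
    minimum is finite and the dummy never wins. *)
Lemma mgbm_feasible w t : positive_types t -> feasible (M w t).1.
Proof.
move=> t0; apply/forallP => j.
have [a [b [aS ua bC ub eT]]] :=
  mgbm_taskP S_neq0 C_neq0 (s w j) (padded_time t j).
have [k ek] : exists k, Some (real_machine k) =
    omap fst (mgbm_task S (s w j) (padded_time t j)).
  rewrite eT /=; case: ifP => _.
    have [|k ->] := @padded_time_fin_num t j a; last by exists k.
    by rewrite ua min_time_real_fin_num.
  have [|k ->] := @padded_time_fin_num t j b; last by exists k.
  by rewrite ub min_time_real_fin_num.
rewrite (_ : [set i | _] = [set k]) ?cards1 //; apply/setP => i.
by rewrite !inE mgbm_allocationE /gets /wins -ek (inj_eq Some_inj)
  (inj_eq (@lshift_inj _ _)) eq_sym.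
Qed.

Lemma mgbm_is_mechanism w : is_mechanism (M w).
Proof.
by move=> t t0; split=> [|i]; [exact: mgbm_feasible | rewrite mgbm_paymentsE].
Qed.

Lemma mgbm_truthful w : truthful (M w).
Proof.
move=> i t t' t0 t'0 tt'.
have uE (v : 'M[R]_(m, n)) : positive_types v ->
    utility t (M w v) i =
    (\sum_j (gets w v i j)%:R * (task_price w v i j - t i j))%:E.
  move=> v0; rewrite /utility mgbm_paymentsE // -EFinB /load -sumrB.
  by congr (_%:E); apply: eq_bigr => j _; rewrite mgbm_allocationE mulrBr.
rewrite !uE // lee_fin; apply: ler_sum => j _.
(* The report of [i] does not enter its own price, so the two utilities can be compared task by task
   at equal prices. *)
have -> : task_price w t' i j = task_price w t i j.
  congr fine; apply: eq_price => k; rewrite /padded_time.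
  case: (splitP k) => l kl //= ne; rewrite tt' //.
  by apply: contraNneq ne => <-; apply/eqP/val_inj.
have := @wins_le_price _ _ S S_neq0 C_neq0 (s w j)
  (padded_time t j) (real_machine i).
have := @price_le_loses _ _ S S_neq0 C_neq0 (s w j)
  (padded_time t j) (real_machine i).
rewrite task_priceE // padded_time_real !lee_fin -/(gets w t i j).
move=> loses won.
(* Under the true report, a task is won only at a nonnegative margin and lost only at a nonpositive
   one, so no other outcome at that price is better. *)
have [gt|/negPf gt] := boolP (gets w t i j).
  by rewrite mul1r; case: gets; rewrite ?mul1r ?mul0r // subr_ge0 won.
by rewrite mul0r; case: gets; rewrite ?mul1r ?mul0r // subr_le0 loses // gt.
Qed.

(** The machine of [A] that runs a task in [x] takes at least the side minimum; summing the loads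
    over the side costs the factor [#|A|]. *)
Lemma side_work t x (A : {set 'I_(padded m)}) (O : pred 'I_n) :
  positive_types t -> #|A| = #|S| ->
  (forall j, O j -> exists2 i, x i j & real_machine i \in A) ->
  \sum_(j | O j) fine (min_time (padded_time t j) A) <= #|A|%:R * makespan t x.
Proof.
move=> t0 cardA onA.
apply: (@le_trans _ _ (\sum_(i | real_machine i \in A) load t x i)).
  rewrite exchange_big [leRHS](bigID O) /= -[leLHS]addr0 lerD //; last first.
    by apply: sumr_ge0 => j _; apply: sumr_ge0 => i _; rewrite mulr_ge0 // ltW.
  apply: ler_sum => j /onA[i xij iA].
  rewrite (bigD1 i) //= xij mul1r -[leLHS]addr0 lerD //; last first.
    by apply: sumr_ge0 => k _; rewrite mulr_ge0 // ltW.
  rewrite -lee_fin fineK ?min_time_real_fin_num //.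
  by rewrite -padded_time_real min_time_le.
apply: (@le_trans _ _ (\sum_(i | real_machine i \in A) makespan t x)).
  by apply: ler_sum => i _; exact: le_bigmax.
rewrite sumr_const -[leLHS]mulr_natl ler_wpM2r //.
  exact: bigmax_ge_id.
(* Only an inequality, since [A] may contain the dummy. *)
rewrite ler_nat -(card_imset _ (@lshift_inj _ (odd m))).
by apply: subset_leq_card; apply/subsetP => _ /imsetP[i iA ->].
Qed.

(** A machine gets only tasks won by its side, at a time equal to the side minimum, so its load is
    at most that of the side seen as one machine. *)
Lemma mgbm_makespan_le w t (a b : 'I_n -> R) : positive_types t ->
  (forall j, min_time (padded_time t j) S = (a j)%:E) ->
  (forall j, min_time (padded_time t j) (~: S) = (b j)%:E) ->
  makespan t (M w t).1 <=
  Num.max (\sum_j (a j < s w j * b j)%R%:R * a j)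
          (\sum_j (~~ (a j < s w j * b j))%:R * b j).
Proof.
move=> t0 aE bE.
have a0 j : 0 <= a j.
  by apply: ltW; rewrite -lte_fin -aE min_time_gt0 // => i;
    exact: padded_time_gt0.
have b0 j : 0 <= b j.
  by apply: ltW; rewrite -lte_fin -bE min_time_gt0 // => i;
    exact: padded_time_gt0.
apply: bigmax_le => [|i _].
  by rewrite le_max sumr_ge0 // => j _; rewrite mulr_ge0.
rewrite le_max; apply/orP.
have winE j : gets w t i j -> if real_machine i \in S
    then t i j = a j /\ a j < s w j * b j
    else t i j = b j /\ s w j * b j <= a j.
  move=> /(winsP S_neq0 C_neq0); rewrite padded_time_real aE bE -EFinM.
  by rewrite lte_fin lee_fin; case: ifP => _ [[->]].
case: (boolP (real_machine i \in S)) winE => iS winE; [left|right];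
  apply: ler_sum => j _; rewrite mgbm_allocationE;
  case: (boolP (gets w t i j)) => [/winE|_]; rewrite ?mul0r ?mulr_ge0 //.
  by case=> -> ->.
by case=> -> h; rewrite -leNgt h.
Qed.

End Mechanism.

(** * The three properties for the given parameters *)

Theorem theorem3p8 (R : realType) (m n : nat) (hm : (1 < m)%N)
    (S : {set 'I_(padded m)}) (hS : #|S| = #|~: S|) :
  let alpha : R := 14844 / 10000 in
  let beta : R := 11854 / 10000 in
  let r : R := 7932 / 10000 in
  let P : {ffun 'I_n -> 'I_4} -> R := mgbm_prob r in
  let M : {ffun 'I_n -> 'I_4} -> mechanism R m n := mgbm alpha beta S in
  [/\ randomized_mechanism P M,
      universally_truthful M
    & approximation_ratio P M (8369 / 10000 * (padded m)%:R)].
Proof.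
move=> alpha beta r P M.
have alphaE : alpha = 148 / 100 + 44 / 100 / 100 := hundredths R 148 44.
have betaE : beta = 118 / 100 + 54 / 100 / 100 := hundredths R 118 54.
have rE : r = 79 / 100 + 32 / 100 / 100 := hundredths R 79 32.
have cE : 8369 / 10000 = 83 / 100 + 69 / 100 / 100 :> R := hundredths R 83 69.
have s_gt0 := gbm_threshold_gt0 alphaE betaE.
(* The four-digit numerals are generalized away, leaving only their expressions in hundredths. *)
rewrite cE {cE}; move: alpha beta r alphaE betaE rE s_gt0 @P @M.
move=> alpha beta r alphaE betaE rE s_gt0 P M.
split.
- split; last by move=> w; exact: mgbm_is_mechanism.
  split=> [w|]; last exact: sum_ffun_cst (gbm_weight_sum r).
  by apply: prodr_ge0 => j _; apply: gbm_weight_ge0.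
- by move=> w; exact: mgbm_truthful.
move=> t t0.
set c : R := _ * _.
have c0 : 0 < c.
  by rewrite mulr_gt0 ?ltr0n ?/padded ?addn_gt0 ?(ltnW hm) //; lra.
(* Dividing by [c > 0] makes the claim a lower bound on a minimum, which is checked against each
   feasible [x]; the default [+oo] is harmless. *)
suff main x : feasible x -> expected_makespan P M t <= c * makespan t x.
  rewrite muleC -lee_pdivrMr //; apply: le_bigmin => [|x xF]; first exact: leey.
  by rewrite -EFinM lee_fin ler_pdivrMr // mulrC main.
move=> /forallP xF.
have runs j : exists i, x i j.
  have /cards1P[i /setP/(_ i)] := xF j.
  by rewrite !inE eqxx => xij; exists i.
have P_ge0 w : 0 <= P w by apply: prodr_ge0 => j _; apply: gbm_weight_ge0.
have x_ge0 : 0 <= makespan t x := bigmax_ge_id _ _ _ _.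
(* Without tasks every makespan is 0 and the scale [T] below would not be positive, so this case is
   separate. *)
have [j0 _|no_task] := pickP (fun _ : 'I_n => true); last first.
  apply: (@le_trans _ _ 0); last by rewrite mulr_ge0 // ltW.
  apply: sumr_le0 => w _; apply: mulr_ge0_le0 => //.
  apply: bigmax_le => // i _; rewrite /load big1 // => j.
  by have := no_task j.
have x_gt0 : 0 < makespan t x.
  have [i xi] := runs j0; apply: (@lt_le_trans _ _ (load t x i)).
    rewrite /load (bigD1 j0) //= xi mul1r ltr_wpDr ?t0 //.
    by apply: sumr_ge0 => j _; rewrite mulr_ge0 // ltW.
  exact: le_bigmax.
pose a j := fine (min_time (padded_time t j) S).
pose b j := fine (min_time (padded_time t j) (~: S)).
have aE j : min_time (padded_time t j) S = (a j)%:E.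
  by rewrite fineK // (min_time_real_fin_num hm hS).
have bE j : min_time (padded_time t j) (~: S) = (b j)%:E.
  by rewrite fineK // (min_time_real_fin_num hm hS).
have a0 j : 0 < a j.
  by rewrite -lte_fin -aE min_time_gt0 // => i; exact: padded_time_gt0.
have b0 j : 0 < b j.
  by rewrite -lte_fin -bE min_time_gt0 // => i; exact: padded_time_gt0.
pose O j := [exists i, x i j && (lshift (odd m) i \in S)].
pose T := #|S|%:R * makespan t x.
have T0 : 0 < T.
  by rewrite mulr_gt0 // ltr0n card_gt0 (S_neq0 hm hS).
have aT : \sum_(j | O j) a j <= T.
  apply: (side_work hm hS) => // j /existsP[i /andP[xij iS]]; by exists i.
have bT : \sum_(j | ~~ O j) b j <= T.
  rewrite /T hS; apply: (side_work hm hS) => // j; have [i xij] := runs j.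
  by rewrite negb_exists => /forallP/(_ i); rewrite xij /= -in_setC; exists i.
have ratioE : 2 * (83 / 100 + 69 / 100 / 100) =
  167 / 100 + 38 / 100 / 100 :> R by field.
(* Here [padded m] is twice [#|S|]: one factor 2 turns 0.8369 into the two-machine ratio, and [#|S|]
   is absorbed in [T]. *)
have -> : c * makespan t x = 2 * (83 / 100 + 69 / 100 / 100) * T.
  by rewrite /c -(card_side hS) natrM /T; ring.
apply: le_trans (two_machine_makespan alphaE betaE ratioE rE a0 b0 T0 aT bT).
by apply: ler_sum => w _; rewrite ler_wpM2l // mgbm_makespan_le.
Qed.
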